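(* Let $\mathcal{K}_1,\mathcal{K}_2$ be simplicial complexes over a set $S$. If $\mathcal{K}_1\neq\mathcal{K}_2$, then there exists $N=N(\mathcal{K}_1,\mathcal{K}_2)$ such that $\pi_N(\mathcal{K}_1)=\pi_N(\mathcal{K}_2)$ and $\pi_{N+1}(\mathcal{K}_1)\neq\pi_{N+1}(\mathcal{K}_2)$. We then have $$\frac{1}{N+2}\leq d(\mathcal{K}_1,\mathcal{K}_2).$$
   Context: $S$ is a fixed set and $\mathcal{P}_f^*(S)$ is the collection of all non-empty finite subsets of $S$. A simplicial complex over $S$ is a non-empty collection $\mathcal{K}\subset\mathcal{P}_f^*(S)$ such that every non-empty subset of an element of $\mathcal{K}$ belongs to $\mathcal{K}$. For $n\geq 0$, let $\mathcal{T}_n$ be the set of non-empty collections $E\subset\mathcal{P}_f^*(S)$ all of whose elements have cardinality at most $n+1$, and let $\mathcal{S}_n$ be the set of simplicial complexes belonging to $\mathcal{T}_n$. The projection $\pi_n$ from the set of simplicial complexes over $S$ to $\mathcal{S}_n$ is defined by $\pi_n(\mathcal{K})=\{F\in\mathcal{K} : \#F\leq n+1\}$. $\Omega$ is a standard measured space, that is, a measured space isomorphic to $[0,1]$ with Lebesgue measure $\lambda$. $L(\mathcal{K})$ is the set of Borel maps $f:\Omega\to S$, identified when equal almost everywhere, such that $f(\Omega)\in\mathcal{K}$ (the image being understood up to null sets). The metric is $d(f,g)=\int_\Omega d(f(t),g(t))\,dt$, where $S$ has the discrete metric; that is, $d(f,g)=\lambda(\{t\in\Omega : f(t)\neq g(t)\})$.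 The distance between simplicial complexes is the Hausdorff distance between the associated spaces of maps: $d(\mathcal{K}_1,\mathcal{K}_2)=\max(\delta(\mathcal{K}_1,\mathcal{K}_2),\delta(\mathcal{K}_2,\mathcal{K}_1))$ with $\delta(\mathcal{K}_1,\mathcal{K}_2)=\sup_{f\in L(\mathcal{K}_1)}\inf_{g\in L(\mathcal{K}_2)}d(f,g)$.
   Formalization: N is allowed to be -1, with π_{-1}(K) empty: if the two complexes have different vertex sets, π_0 already differs and no N ≥ 0 satisfies the stated condition; in that case the bound reads 1 ≤ d(K_1,K_2). *)

(* Defs.v *)
From HB Require Import structures.
From mathcomp Require Import all_boot all_order all_algebra finmap.
From mathcomp Require Import all_classical all_reals all_analysis.

Set Implicit Arguments.
Unset Strict Implicit.
Unset Printing Implicit Defensive.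

Import Order.TTheory GRing.Theory Num.Theory.
Local Open Scope classical_set_scope.
Local Open Scope ring_scope.

Definition simplicial_complex (S : choiceType) (K : set {fset S}) : Prop :=
  [/\ K !=set0,
      forall F, K F -> F != fset0
    & forall F G, K F -> (G `<=` F)%fset -> G != fset0 -> K G].

(* [n] is an integer so that n = -1 is allowed: [skeleton (-1) K] is empty for
   a simplicial complex [K], and two complexes with different vertex sets do not
   agree at any level n >= 0. *)
Definition skeleton (S : choiceType) (n : int) (K : set {fset S}) :
  set {fset S} := [set F | K F /\ (#|` F|%fset%:Z <= n + 1)].

(* [S] with the discrete sigma-algebra, i.e. the Borel sets of the discrete
   topology.  MathComp-Analysis requires the carrier of a measurable space to be
   pointed; this costs no generality here, since a set over which there is a
   simplicial complex is non-empty. *)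
Definition discr (S : Type) : Type := S.
HB.instance Definition _ (S : pointedType) := Pointed.on (discr S).
HB.instance Definition _ (S : pointedType) :=
  @isMeasurable.Build default_measure_display (discr S)
    discrete_measurable discrete_measurable0
    discrete_measurableC discrete_measurableU.

Section isomorphism.
Context {d1 d2 : measure_display} {R : realType}.
Context {T1 : measurableType d1} {T2 : measurableType d2}.

(* Isomorphism of measured spaces modulo null sets: a bimeasurable
   measure-preserving bijection [f], with inverse [g], between sets [A1] and
   [A2] of full measure. *)
Definition isomorphic_mod0 (mu1 : {measure set T1 -> \bar R})
    (mu2 : {measure set T2 -> \bar R}) : Prop :=
  exists (A1 : set T1) (A2 : set T2) (f : T1 -> T2) (g : T2 -> T1),
    [/\ measurable A1, measurable A2, mu1 (~` A1) = 0%E & mu2 (~` A2) = 0%E] /\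
    [/\ set_bij A1 A2 f, {in A1, cancel f g},
        measurable_fun A1 f, measurable_fun A2 g
      & forall C, measurable C -> mu1 (A1 `&` f @^-1` C) = mu2 C].

End isomorphism.

(* The Lebesgue measure of [0,1] is seen as a measure on R carried by [0,1],
   which is the same thing up to a null set. *)
Definition standard_measured_space (d : measure_display) (R : realType)
    (T : measurableType d) (mu : {measure set T -> \bar R}) : Prop :=
  isomorphic_mod0 mu
    (mrestr (@lebesgue_measure R) (measurable_itv `[(0 : R), 1])).

Section maps.
Context {d : measure_display} {R : realType} {T : measurableType d}.
Variable mu : {measure set T -> \bar R}.
Variable S : pointedType.

(* [{mfun_ mu, T >-> discr S}] is the quotient of the measurable maps by
   equality [mu]-almost everywhere; the condition on the image bears on some
   representative [f] of the class [u]. *)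
Definition Lmaps (K : set {fset S}) : set {mfun_ mu, T >-> discr S} :=
  [set u | exists f : {mfun T >-> discr S},
    (u : T -> discr S) = f %[ae mu] /\
    exists2 F : {fset S}, K F & range f = [set` F]].

Definition discrete_dist (x y : S) : R := (x != y)%:R.

Definition map_dist (u v : {mfun_ mu, T >-> discr S}) : \bar R :=
  (\int[mu]_t (discrete_dist (u t) (v t))%:E)%E.

Definition complex_excess (K1 K2 : set {fset S}) : \bar R :=
  ereal_sup [set ereal_inf [set map_dist u v | v in Lmaps K2] | u in Lmaps K1].

Definition complex_dist (K1 K2 : set {fset S}) : \bar R :=
  Order.max (complex_excess K1 K2) (complex_excess K2 K1).

End maps.

(* Main.v *)
From HB Require Import structures.
Require Import Defs.
From mathcomp Require Import all_boot all_order all_algebra finmap.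
From mathcomp Require Import all_classical all_reals all_analysis.
From mathcomp Require Import measurable_realfun.
From mathcomp Require Import zify.

Set Implicit Arguments.
Unset Strict Implicit.
Unset Printing Implicit Defensive.

Import Order.TTheory GRing.Theory Num.Theory.
Import HBNNSimple.

Local Open Scope classical_set_scope.
Local Open Scope ring_scope.

(** Two distinct complexes first differ at the smallest cardinality [n] of a
    finite set that is a face of exactly one of them; this gives the level
    [N = n - 2], which is [-1] when the vertex sets already differ.

    For the distance, let [F] be a face of one complex, say [K1], and not of
    the other, with [c <= N + 2] elements.  Cut the measured space into [c]
    pieces of measure [1/c] and let [f] be constant on each of them, taking
    every vertex of [F] once ([equipartition_map]).  The image of any [g] in
    [Lmaps K2] is a face of [K2], so it cannot contain [F]: otherwise [F] would
    be a face of [K2].  Hence [g] misses some vertex [s] of [F], and differs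
    from [f] on the whole fiber of [f] above [s], which has measure [1/c]
    ([measure_fiber_le_map_dist]).  So [f] lies at distance at least
    [1/c >= 1/(N + 2)] from all of [Lmaps K2]. *)

Lemma differing_face_neq0 (S : choiceType) (K1 K2 : set {fset S})
    (F : {fset S}) :
  simplicial_complex K1 -> simplicial_complex K2 -> K1 F <> K2 F ->
  F != fset0.
Proof.
move=> [_ K1n0 _] [_ K2n0 _]; apply: contra_notN => F0; apply/propext.
by split => [/K1n0|/K2n0]; rewrite F0.
Qed.

Lemma exists_first_difference (S : choiceType) (K1 K2 : set {fset S})
    (hK1 : simplicial_complex K1) (hK2 : simplicial_complex K2)
    (hK : K1 <> K2) :
  exists N : int, [/\ -1 <= N, skeleton N K1 = skeleton N K2
     & skeleton (N + 1) K1 <> skeleton (N + 1) K2].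
Proof.
pose P n := `[< exists2 F, K1 F <> K2 F & #|` F|%fset = n >].
have exP : exists n, P n.
  apply: contrapT => noP; apply: hK; apply/funext => F.
  apply: contrapT => KF; apply: noP.
  by exists #|` F|%fset; apply/asboolP; exists F.
case: (ex_minnP exP) => n /asboolP[F KF Fn] n_min.
have n_gt0 : (0 < n)%N.
  by rewrite -Fn cardfs_gt0; exact: differing_face_neq0 hK1 hK2 KF.
exists (n%:Z - 2); split; first by lia.
- have KE G : #|` G|%fset%:Z <= n%:Z - 2 + 1 -> K1 G = K2 G.
    move=> cG; apply: contrapT => KG.
    have /n_min : P #|` G|%fset by apply/asboolP; exists G.
    lia.
  by apply/seteqP; split => G [KG cG]; split => //;
    [rewrite -KE|rewrite KE].
- move=> /(congr1 (fun K => K F)) skE; apply: KF; apply/propext.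
  have cF : #|` F|%fset%:Z <= n%:Z - 2 + 1 + 1 by lia.
  split => KF; first by have [] : skeleton (n%:Z - 2 + 1) K2 F by rewrite -skE.
  by have [] : skeleton (n%:Z - 2 + 1) K1 F by rewrite skE.
Qed.

Lemma measurable_truncn (R : realType) :
  measurable_fun [set: R] (@Num.truncn R).
Proof.
move=> _ Y _; rewrite setTI.
have -> : Num.truncn @^-1` Y = \bigcup_(n in Y) (@Num.truncn R @^-1` [set n]).
  by apply/seteqP; split => [x Yx|x [n Yn /= ->]//]; exists (Num.truncn x).
apply: bigcup_measurable => -[|n] _.
  rewrite (_ : _ @^-1` _ = [set` `]-oo, 1[%R]); first exact: measurable_itv.
  by apply/seteqP; split => x /=;
    rewrite in_itv /= -(truncn_le_nat x 0) leqn0 => /eqP.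
rewrite (_ : _ @^-1` _ = [set` `[n.+1%:R, n.+2%:R[%R]).
  exact: measurable_itv.
by apply/seteqP; split => x /=;
  rewrite in_itv /= -truncn_le_nat -truncn_gt_nat andbC -eqn_leq => /eqP.
Qed.

(** The simple function [\1_A] lies below [h], and the integral of a
    nonnegative function is a supremum over such simple functions.  Arguing
    with [A] rather than with [h] matters for the indicator of the set where two
    maps into [discr S] differ: when [S] is larger than the continuum, the
    diagonal is not measurable in the product, so that the measurability of
    this set does not follow from that of the two maps. *)
Lemma measurable_le_integral d (T : measurableType d) (R : realType)
    (mu : {measure set T -> \bar R}) (A : set T) (h : T -> R) :
  measurable A -> (forall x, 0 <= h x) -> (forall x, A x -> 1 <= h x) ->
  (mu A <= \int[mu]_x (h x)%:E)%E.
Proof.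
move=> mA h0 h1; rewrite ge0_integralE; last by move=> x _; rewrite lee_fin.
apply: ereal_sup_ubound; exists (indic_nnsfun R mA); last by rewrite -sintegral_indic.
move=> x; rewrite patch_setT lee_fin (_ : indic_nnsfun R mA x = \1_A x)// indicE.
by case: (boolP (x \in A)) => [/set_mem/h1|_] /=.
Qed.

Section distance_to_maps.
Context d (T : measurableType d) (R : realType).
Variable mu : {measure set T -> \bar R}.
Variable S : pointedType.

(** The [i]-th vertex of [F] is the value of [f] on the points that the
    isomorphism sends to the [i]-th of the [#|` F|] equal subintervals of
    [0,1].  The fibers have total measure 1, so that these lower bounds are
    equalities. *)
Lemma equipartition_map (F : {fset S}) :
  standard_measured_space mu -> F != fset0 ->
  exists2 f : {mfun T >-> discr S}, range f = [set` F] &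
    forall s, s \in F -> ((#|` F|%fset%:R^-1 : R)%:E <= mu (f @^-1` [set s]))%E.
Proof.
move=> [A1 [A2 [f0 [g0 [[mA1 mA2 _ _] [_ _ mf0 _ f0mu]]]]]] Fn0.
set c := #|` F|%fset.
have c_gt0 : (0 : R) < c%:R by rewrite ltr0n cardfs_gt0.
have [s0 s0F] := fset0Pn _ Fn0.
(* The endpoint 1 gives an index beyond the last vertex, and the points outside
   A1 give the index 0; the default [s0] keeps all values in F. *)
pose idx (t : T) : nat := Num.truncn (c%:R * (f0 \_ A1) t).
pose f (t : T) : discr S := nth s0 (enum_fset F) (idx t).
have midx : measurable_fun [set: T] idx.
  apply: (measurableT_comp (@measurable_truncn R)).
  by apply: measurable_funM => //; exact/(measurable_restrictT f0 mA1).1.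
have mf : measurable_fun [set: T] f
  by move=> mT Y _; exact: (midx mT (nth s0 (enum_fset F) @^-1` Y)).
have f_ge s : s \in F -> ((c%:R^-1 : R)%:E <= mu (f @^-1` [set s]))%E.
  move=> sF; set i := index s (enum_fset F).
  have ic : (i < c)%N by rewrite index_mem.
  pose I : set R := [set` `[i%:R / c%:R, i.+1%:R / c%:R[%R].
  have mI : measurable I by exact: measurable_itv.
  have -> : ((c%:R^-1 : R)%:E = mu (A1 `&` f0 @^-1` I))%E.
    rewrite f0mu//= /mrestr setIidl.
      rewrite lebesgue_measure_itv /= lte_fin ltr_pM2r ?invr_gt0// ltr_nat ltnSn.
      by rewrite -EFinB -mulrBl -natrB// subSnn mul1r.
    move=> x; rewrite /I /= !in_itv /= => /andP[xi xi1]; apply/andP; split.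
      by apply: le_trans xi; rewrite divr_ge0// ltW.
    by rewrite (le_trans (ltW xi1))// ler_pdivrMr// mul1r ler_nat.
  apply: le_measure; rewrite ?inE.
  - exact: mf0.
  - by rewrite -[X in measurable X]setTI; exact: mf.
  move=> t [A1t]; rewrite /I /= in_itv /= => /andP[ti ti1].
  rewrite /f /idx patchT ?inE// (_ : Num.truncn _ = i) ?nth_index//.
  by apply: truncn_def; rewrite mulrC -ler_pdivrMr// ti -ltr_pdivlMr.
pose fm : {mfun T >-> discr S} := HB.pack f (isMeasurableFun.Build _ _ _ _ f mf).
(* Fibers of positive measure are non-empty, which gives surjectivity onto F. *)
exists fm => //; apply/seteqP; split => [_ [t _ <-]|s sF] /=.
  rewrite /f; have [ltc|gec] := ltnP (idx t) (size (enum_fset F)).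
    exact: mem_nth.
  by rewrite nth_default.
have : (0 < mu (f @^-1` [set s]))%E.
  by apply: lt_le_trans (f_ge s sF); rewrite lte_fin invr_gt0.
have [->|/set0P[t fts] _] := eqVneq (f @^-1` [set s]) set0.
  by rewrite measure0 ltxx.
by exists t.
Qed.

(** Off a null set, [u] and [v] differ wherever [f] takes the value [s], since
    [g] never takes it. *)
Lemma measure_fiber_le_map_dist (u v : {mfun_ mu, T >-> discr S})
    (f g : {mfun T >-> discr S}) (s : S) :
  (u : T -> discr S) = f %[ae mu] -> (v : T -> discr S) = g %[ae mu] ->
  ~ range g s -> (mu (f @^-1` [set s]) <= map_dist u v)%E.
Proof.
move=> uf vg gs; have [N [mN N0 notN]] := filterI uf vg.
have mfs : measurable (f @^-1` [set s]).
  by rewrite -[X in measurable X]setTI; exact: measurable_funP.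
have le_off_N : (mu (f @^-1` [set s]) <= mu (f @^-1` [set s] `\` N))%E.
  rewrite -[leRHS](measureU0 _ mN N0); last exact: measurableD.
  apply: le_measure; rewrite ?inE//.
    by apply: measurableU => //; exact: measurableD.
  by move=> t fts; have [Nt|Nt] := pselect (N t); [right|left].
apply: (le_trans le_off_N).
apply: measurable_le_integral; first exact: measurableD.
  by move=> t; rewrite /discrete_dist; case: eqP.
move=> t [/= fts Nt]; rewrite /discrete_dist; case: eqP => //= uv.
have [ut vt] : (setT t -> u t = f t) /\ (setT t -> v t = g t).
  by apply: contrapT => /notN.
by case: gs; exists t => //; rewrite -vt// -uv ut.
Qed.

(** The infimum over [Lmaps K2] is bounded below for a single map, the
    equidistributed one on [F]; closure of [K2] under faces gives, for each
    competitor, a vertex of [F] outside its image. *)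
Lemma complex_excess_ge (K1 K2 : set {fset S}) (F : {fset S}) :
  standard_measured_space mu ->
  simplicial_complex K2 -> F != fset0 -> K1 F -> ~ K2 F ->
  ((#|` F|%fset%:R^-1 : R)%:E <= complex_excess mu K1 K2)%E.
Proof.
move=> hmu [_ _ K2sub] F_n0 K1F K2F.
have [f fF f_ge] := equipartition_map hmu F_n0.
pose u : {mfun_ mu, T >-> discr S} := (\pi_({mfun_ mu, T >-> discr S}) f)%qT.
have uf : (u : T -> discr S) = f %[ae mu].
  by have /eqP := reprK u; rewrite eqmodE => /asboolP.
apply: le_ereal_sup_tmp; exists (ereal_inf [set map_dist u v | v in Lmaps K2]).
  by exists u => //; exists f; split => //; exists F.
apply: le_ereal_inf_tmp => _ [v [g [vg [G K2G gG]]] <-].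
have [s sF sG] : exists2 s, s \in F & s \notin G.
  by apply/fsubsetPn; apply: contra_notN K2F => FG; exact: K2sub K2G FG F_n0.
apply: le_trans (f_ge s sF) _.
by apply: measure_fiber_le_map_dist uf vg _; rewrite gG => /(negP sG).
Qed.
End distance_to_maps.

Theorem corollary2p10 (R : realType) (d : measure_display)
    (T : measurableType d) (mu : {measure set T -> \bar R})
    (S : pointedType) (K1 K2 : set {fset S})
    (hmu : standard_measured_space mu)
    (hK1 : simplicial_complex K1) (hK2 : simplicial_complex K2)
    (hK : K1 <> K2) :
  (exists N : int, [/\ -1 <= N, skeleton N K1 = skeleton N K2
     & skeleton (N + 1) K1 <> skeleton (N + 1) K2]) /\
  (forall N : int, -1 <= N -> skeleton N K1 = skeleton N K2 ->
     skeleton (N + 1) K1 <> skeleton (N + 1) K2 ->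
     ((1 / (N + 2)%:~R)%:E <= complex_dist mu K1 K2)%E).
Proof.
split; first exact: exists_first_difference.
move=> N _ _ skN.
have [F FN KF] : exists2 F : {fset S}, #|` F|%fset%:Z <= N + 2 & K1 F <> K2 F.
  apply: contrapT => noF; apply: skN; apply/funext => F; apply/propext.
  rewrite /skeleton /= (_ : N + 1 + 1 = N + 2); last by lia.
  by split => -[KF FN]; split => //; apply: contrapT => KF'; apply: noF;
    exists F => // KE; apply: KF'; rewrite ?KE // -KE.
have F_n0 := differing_face_neq0 hK1 hK2 KF.
apply: (@le_trans _ _ (#|` F|%fset%:R^-1 : R)%:E).
  move: F_n0; rewrite -cardfs_gt0 => c_gt0.
  rewrite lee_fin div1r lef_pV2 ?posrE ?ltr0n ?ltr0z//; last by lia.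
  by rewrite pmulrn ler_int.
rewrite /complex_dist le_max; apply/orP.
have [K1F|K1F] := pselect (K1 F); have [K2F|K2F] := pselect (K2 F).
- by case: KF; apply/propext.
- by left; exact: complex_excess_ge.
- by right; exact: complex_excess_ge.
- by case: KF; apply/propext.
Qed.
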